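(* Confluence, local confluence, the normal form property and the cofinality property are not first-order definable. More precisely, none of $\mathrm{CR}$, $\mathrm{WCR}$, $\mathrm{NFP}$, $\mathrm{CP}$, $\neg\mathrm{CR}$, $\neg\mathrm{WCR}$, $\neg\mathrm{NFP}$, $\neg\mathrm{CP}$ is a generalised first-order property of abstract rewrite systems.
   Context: An ARS is a pair $(A,\to)$, $A$ non-empty, ${\to}\subseteq A\times A$; $\twoheadrightarrow$ is the reflexive transitive closure and $\leftrightarrow^*$ the reflexive transitive closure of ${\to}\cup{\leftarrow}$. CR (confluence): $a\twoheadrightarrow b$, $a\twoheadrightarrow c$ imply $b\twoheadrightarrow d$, $c\twoheadrightarrow d$ for some $d$. WCR (local confluence): $a\to b$, $a\to c$ imply $b\twoheadrightarrow d$, $c\twoheadrightarrow d$ for some $d$. A normal form is an element with no outgoing step; NFP: for all $a$ and normal forms $b$, $a\leftrightarrow^*b$ implies $a\twoheadrightarrow b$. CP (cofinality property): for every $a\in A$ there is a finite or infinite reduction $a=b_0\to b_1\to\cdots$ such that every $x$ with $a\twoheadrightarrow x$ satisfies $x\twoheadrightarrow b_i$ for some $i$. $\neg P$ is the property of not having $P$. A property $P$ is a generalised first-order property if there is a set $\Phi$ of sentences of first-order logic with equality and a binary predicate symbol $\to$ (interpreted as the one-step relation) such that for every ARS $\mathcal{A}$, $\mathcal{A}$ has $P$ iff $\mathcal{A}\models\Phi$. *)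

(* Defs.v *)
From Stdlib Require Import Relation_Operators.
From Stdlib Require Vectors.Fin Vectors.Vector.

Record ARS : Type := MkARS {
  carrier :> Type;
  step : carrier -> carrier -> Prop;
  carrier_inhabited : inhabited carrier
}.

Arguments step {_} _ _.

Definition reduces {A : ARS} : A -> A -> Prop := clos_refl_trans A (@step A).

Definition convertible {A : ARS} : A -> A -> Prop :=
  clos_refl_trans A (union A (@step A) (transp A (@step A))).

Definition CR (A : ARS) : Prop :=
  forall a b c : A, reduces a b -> reduces a c ->
    exists d : A, reduces b d /\ reduces c d.

Definition WCR (A : ARS) : Prop :=
  forall a b c : A, step a b -> step a c ->
    exists d : A, reduces b d /\ reduces c d.

Definition normal_form {A : ARS} (b : A) : Prop := ~ exists c : A, step b c.

Definition NFP (A : ARS) : Prop :=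
  forall a b : A, normal_form b -> convertible a b -> reduces a b.

(* A finite reduction b 0 -> ... -> b n has length [Some n], an infinite one
   has length [None]; [index l i] says that position [i] occurs in a reduction
   of length [l]. Values of [b] at other positions are irrelevant. *)
Definition index (l : option nat) (i : nat) : Prop :=
  match l with
  | Some n => i <= n
  | None => True
  end.

Definition is_reduction {A : ARS} (l : option nat) (b : nat -> A) : Prop :=
  forall i : nat, index l (S i) -> step (b i) (b (S i)).

Definition CP (A : ARS) : Prop :=
  forall a : A, exists (l : option nat) (b : nat -> A),
    b 0 = a /\ is_reduction l b /\
    forall x : A, reduces a x -> exists i : nat, index l i /\ reduces x (b i).

(* First-order formulas with free variables among n de Bruijn indices;
   a quantifier binds index [Fin.F1] of its body. *)
Inductive formula : nat -> Type :=
  | Bot : forall {n : nat}, formula n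
  | Eq : forall {n : nat}, Fin.t n -> Fin.t n -> formula n
  | Step : forall {n : nat}, Fin.t n -> Fin.t n -> formula n
  | And : forall {n : nat}, formula n -> formula n -> formula n
  | Or : forall {n : nat}, formula n -> formula n -> formula n
  | Imp : forall {n : nat}, formula n -> formula n -> formula n
  | All : forall {n : nat}, formula (S n) -> formula n
  | Ex : forall {n : nat}, formula (S n) -> formula n.

Definition sentence : Type := formula 0.

Fixpoint sat (A : ARS) {n : nat} (phi : formula n) : Vector.t A n -> Prop :=
  match phi in formula m return Vector.t A m -> Prop with
  | Bot => fun _ => False
  | Eq x y => fun v => Vector.nth v x = Vector.nth v y
  | Step x y => fun v => step (Vector.nth v x) (Vector.nth v y)
  | And p q => fun v => sat A p v /\ sat A q v
  | Or p q => fun v => sat A p v \/ sat A q v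
  | Imp p q => fun v => sat A p v -> sat A q v
  | All p => fun v => forall a : A, sat A p (Vector.cons A a _ v)
  | Ex p => fun v => exists a : A, sat A p (Vector.cons A a _ v)
  end.

Definition models (A : ARS) (Phi : sentence -> Prop) : Prop :=
  forall phi : sentence, Phi phi -> sat A phi (Vector.nil A).

Definition generalised_first_order (P : ARS -> Prop) : Prop :=
  exists Phi : sentence -> Prop, forall A : ARS, P A <-> models A Phi.

Definition neg_prop (P : ARS -> Prop) : ARS -> Prop := fun A => ~ P A.

(* Main.v *)
From Stdlib Require Import Relation_Operators.
From mathcomp Require Import all_boot zify.
From mathcomp Require Import boolp classical_sets filter.
Require Import Defs.

Set Implicit Arguments.
Unset Strict Implicit.
Unset Printing Implicit Defensive.

(** An ARS satisfies the same sentences as its ultrapowers, so a single ARS [A]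
    having all four properties, with an ultrapower having none of them, refutes
    the eight definability claims at once.  Take for [A] the disjoint union over
    [n] of the chains [... -> 2 -> 1 -> 0], the [n]-th one with an additional
    step [n + 1 -> 0].  In an ultrapower over a non-principal ultrafilter, the
    class of [n + 1] has two one-step reducts: the normal form [0] and the class
    of [n], whose reducts are the classes of [n - k] for standard [k], none of
    which is [0]. *)

(** * Implications among the four properties *)

Lemma reduction_reduces (A : ARS) (l : option nat) (b : nat -> A) (i j : nat) :
  is_reduction l b -> index l j -> i <= j -> reduces (b i) (b j).
Proof.
move=> red_b; elim: j => [|j IHj] idx_j le_ij.
  by move: le_ij; rewrite leqn0 => /eqP ->; apply: rt_refl.
have [->|ne_ij] := eqVneq i j.+1; first exact: rt_refl.
apply: (rt_trans _ _ _ (b j)); last exact/rt_step/red_b.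
by apply: IHj; [case: l idx_j {red_b} => //= n; lia | lia].
Qed.

(** Both reducts of [a] reduce into one cofinal reduction from [a]; the later of the two positions
    reached is a common reduct. *)
Lemma CP_CR (A : ARS) : CP A -> CR A.
Proof.
move=> cpA a b c ab ac.
have [l [s [_ [red_s cof_s]]]] := cpA a.
have [i [idx_i bi]] := cof_s _ ab.
have [j [idx_j cj]] := cof_s _ ac.
have [le_ij|/ltnW le_ji] := leqP i j.
- exists (s j); split=> //; apply: rt_trans bi _.
  exact: reduction_reduces red_s idx_j le_ij.
- exists (s i); split=> //; apply: rt_trans cj _.
  exact: reduction_reduces red_s idx_i le_ji.
Qed.

Lemma CR_WCR (A : ARS) : CR A -> WCR A.
Proof. by move=> crA a b c ab ac; apply: (crA a); apply: rt_step. Qed.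

Lemma CR_church_rosser (A : ARS) (a b : A) :
  CR A -> convertible a b -> exists d : A, reduces a d /\ reduces b d.
Proof.
move=> crA; elim=> {a b} [a b [ab|ba] | a | a b c _ [d [ad bd]] _ [e [be ce]]].
- by exists b; split; [apply: rt_step | apply: rt_refl].
- by exists a; split; [apply: rt_refl | apply: rt_step].
- by exists a; split; apply: rt_refl.
- have [f [df ef]] := crA _ _ _ bd be.
  by exists f; split; [apply: rt_trans ad df | apply: rt_trans ce ef].
Qed.

Lemma normal_form_reduces (A : ARS) (a b : A) :
  normal_form a -> reduces a b -> b = a.
Proof.
move=> + ab; elim: ab => {a b} [a b ab | // | a b c _ IHb _ IHc] nfa.
- by case: nfa; exists b.
- by have eb := IHb nfa; rewrite IHc eb.
Qed.

Lemma CR_NFP (A : ARS) : CR A -> NFP A.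
Proof.
move=> crA a b nfb /(CR_church_rosser crA)[d [ad bd]].
by rewrite -(normal_form_reduces nfb bd).
Qed.

(** * Definability and elementary equivalence *)

Definition elementarily_equivalent (A B : ARS) : Prop :=
  forall phi : sentence,
    sat A phi (Vector.nil A) <-> sat B phi (Vector.nil B).

Lemma generalised_first_order_equiv (P : ARS -> Prop) (A B : ARS) :
  generalised_first_order P -> elementarily_equivalent A B -> P A <-> P B.
Proof.
move=> [Phi defP] AB; rewrite !defP.
by split=> mod phi /mod; rewrite AB.
Qed.

Lemma not_generalised_first_order (P : ARS -> Prop) (A B : ARS) :
  elementarily_equivalent A B -> P A -> ~ P B ->
  ~ generalised_first_order P /\ ~ generalised_first_order (neg_prop P).
Proof.
move=> AB PA PB; split=> foP; have [PAB PBA] := generalised_first_order_equiv foP AB.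
- exact/PB/PAB.
- exact: PBA PB PA.
Qed.

(** * Ultrapowers and the theorem of Łoś *)

Section Ultrapower.
Variables (I : Type) (U : set_system I) (A : ARS).
Hypothesis ultraU : UltraFilter U.

Let properU : ProperFilter U := ultra_proper.

(** Maximality of [U] enters here; the laws for disjunction, implication and the universal
    quantifier rest on it. *)
Lemma ultra_not (P : set I) : U (fun i => ~ P i) <-> ~ U P.
Proof.
split=> [UnP UP | nUP].
- by have [i [/= nPi Pi]] := filter_ex (filterI UnP UP).
- by have [] := in_ultra_setVsetC P ultraU.
Qed.

Lemma ultra_and (P Q : set I) : U (fun i => P i /\ Q i) <-> U P /\ U Q.
Proof.
split=> [UPQ | [UP UQ]]; last exact: filterI.
by split; apply: filterS UPQ => i [].
Qed.

Lemma ultra_or (P Q : set I) : U (fun i => P i \/ Q i) <-> U P \/ U Q.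
Proof.
split=> [UPQ | [UP|UQ]]; last 2 first.
- by apply: filterS UP => i; left.
- by apply: filterS UQ => i; right.
- have [UP|/ultra_not UnP] := pselect (U P); [by left | right].
  by apply: filterS (filterI UnP UPQ) => i [/= nP []].
Qed.

Lemma ultra_imp (P Q : set I) : U (fun i => P i -> Q i) <-> (U P -> U Q).
Proof.
split=> [UPQ UP | PQ]; first by apply: filterS (filterI UPQ UP) => i [/= + p]; apply.
have [/PQ UQ|/ultra_not UnP] := pselect (U P).
- by apply: filterS UQ => i.
- by apply: filterS UnP => i nP /nP.
Qed.

Lemma ultra_exists (P : I -> A -> Prop) :
  (exists f : I -> A, U (fun i => P i (f i))) <-> U (fun i => exists a, P i a).
Proof.
split=> [[f] | UexP]; first by apply: filterS => i Pi; exists (f i).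
(* Choice needs a total function: at indices without a witness, an arbitrary element of the
   non-empty carrier serves as default. *)
have [f fP] : {f : I -> A & forall i, (exists a, P i a) -> P i (f i)}.
  apply: (@choice _ _ (fun i b => (exists a, P i a) -> P i b)) => i.
  have [[a Pa]|nP] := pselect (exists a, P i a); first by exists a.
  by case: (carrier_inhabited A) => a; exists a => /nP.
by exists f; apply: filterS UexP.
Qed.

Lemma ultra_forall (P : I -> A -> Prop) :
  (forall f : I -> A, U (fun i => P i (f i))) <-> U (fun i => forall a, P i a).
Proof.
split=> [allP | UallP f]; last by apply: filterS UallP => i.
apply: contrapT => /ultra_not UnP.
have [f /ultra_not] : exists f : I -> A, U (fun i => ~ P i (f i)).
  apply/(@ultra_exists (fun i a => ~ P i a)).
  by apply: filterS UnP => i /existsNP.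
exact.
Qed.

Definition ae_eq (f g : I -> A) : Prop := U (fun i => f i = g i).

(** Elements are equivalence classes represented as predicates, so that equality in the ultrapower,
    which interprets [Eq], is Leibniz equality. *)
Definition ultra_carrier : Type :=
  {c : (I -> A) -> Prop | exists f : I -> A, c = ae_eq f}.

Definition ultra_class (f : I -> A) : ultra_carrier :=
  exist _ (ae_eq f) (ex_intro _ f erefl).

Lemma ultra_class_surj (c : ultra_carrier) : exists f, c = ultra_class f.
Proof. by case: c => c [f cE]; exists f; apply: eq_exist. Qed.

Lemma ultra_class_eq (f g : I -> A) :
  ultra_class f = ultra_class g <-> U (fun i => f i = g i).
Proof.
split=> [/(congr1 (@proj1_sig _ _))/= fg | fg].
- by rewrite -/(ae_eq f g) fg; apply: filterE.
- apply: eq_exist; apply/funext => h; apply/propext.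
  by split=> H; apply: filterS (filterI fg H) => i [/= -> ->].
Qed.

Definition ultra_step (c d : ultra_carrier) : Prop :=
  exists f g : I -> A,
    [/\ c = ultra_class f, d = ultra_class g & U (fun i => step (f i) (g i))].

Lemma ultra_inhabited : inhabited ultra_carrier.
Proof.
by case: (carrier_inhabited A) => a; split; apply: ultra_class => _; exact: a.
Qed.

Definition ultrapower : ARS := MkARS ultra_carrier ultra_step ultra_inhabited.

Lemma ultra_stepE (f g : I -> A) :
  @step ultrapower (ultra_class f) (ultra_class g)
  <-> U (fun i => step (f i) (g i)).
Proof.
split=> [[f' [g' [/ultra_class_eq ff' /ultra_class_eq gg' fg]]] | fg].
- by apply: filterS (filterI fg (filterI ff' gg')) => i /= [+ [-> ->]].
- by exists f, g.
Qed.

Definition eval_at (i : I) (n : nat) (v : Vector.t (I -> A) n) : Vector.t A n :=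
  Vector.map (fun f => f i) v.

Definition class_vector (n : nat) (v : Vector.t (I -> A) n) :
  Vector.t ultrapower n := Vector.map ultra_class v.

Lemma nth_eval (i : I) (n : nat) (v : Vector.t (I -> A) n) (x : Fin.t n) :
  Vector.nth (eval_at i v) x = Vector.nth v x i.
Proof. exact: Vector.nth_map. Qed.

Lemma nth_class (n : nat) (v : Vector.t (I -> A) n) (x : Fin.t n) :
  Vector.nth (class_vector v) x = ultra_class (Vector.nth v x).
Proof. exact: Vector.nth_map. Qed.

(** Induction on the formula: each connective commutes with membership in [U], and a quantifier over
    classes becomes one over representing functions. *)
Theorem los (n : nat) (phi : formula n) (v : Vector.t (I -> A) n) :
  sat ultrapower phi (class_vector v)
  <-> U (fun i => sat A phi (eval_at i v)).
Proof.
elim: phi v => {n} /= [n|n x y|n x y|n p IHp q IHq|n p IHp q IHq|n p IHp q IHq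
                      |n p IHp|n p IHp] v.
- by split=> // /filter_ex[].
- rewrite !nth_class; under [X in U X]eq_fun do rewrite !nth_eval.
  exact: ultra_class_eq.
- rewrite !nth_class; under [X in U X]eq_fun do rewrite !nth_eval.
  exact: ultra_stepE.
- by rewrite ultra_and IHp IHq.
- by rewrite ultra_or IHp IHq.
- by rewrite ultra_imp IHp IHq.
(* Both [class_vector] and [eval_at] commute with [Vector.cons] by computation, so the induction
   hypothesis applies to the vector extended by a representative [f]. *)
- rewrite -(ultra_forall
    (fun i a => sat A p (Vector.cons A a n (eval_at i v)))); split=> [all_p f | all_p c].
  + exact/(IHp (Vector.cons _ f _ v))/all_p.
  + by have [f ->] := ultra_class_surj c; apply/(IHp (Vector.cons _ f _ v))/all_p.
- rewrite -(ultra_exists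
    (fun i a => sat A p (Vector.cons A a n (eval_at i v)))); split=> [[c] | [f pf]].
  + by have [f ->] := ultra_class_surj c; exists f; apply/(IHp (Vector.cons _ f _ v)).
  + by exists (ultra_class f); apply/(IHp (Vector.cons _ f _ v)).
Qed.

Lemma ultrapower_equiv : elementarily_equivalent A ultrapower.
Proof.
move=> phi; rewrite (los phi (Vector.nil _)) /=; split=> [satA | /filter_ex[] //].
exact: filterE.
Qed.

End Ultrapower.

(** * The chains, which have all four properties *)

(* [(n, i)] is the element [i] of the [n]-th chain. *)
Definition chain_step (x y : nat * nat) : Prop :=
  x.1 = y.1 /\ (x.2 = y.2.+1 \/ x.2 = x.1.+1 /\ y.2 = 0).

Definition chains : ARS := MkARS (nat * nat) chain_step (inhabits (0, 0)).

Lemma chains_reduce_fst (x y : chains) : reduces x y -> x.1 = y.1.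
Proof. by elim=> {x y} [x y []| |x y z _ -> _]. Qed.

Lemma chains_reduce_bottom (n i : nat) : @reduces chains (n, i) (n, 0).
Proof.
elim: i => [|i IHi]; first exact: rt_refl.
by apply: rt_trans IHi; apply: rt_step; split=> //; left.
Qed.

Lemma chains_CP : CP chains.
Proof.
(* Walking down one by one reaches [(n, 0)] after exactly [i] steps; every reduct stays in chain [n]
   and so reduces to [(n, 0)]. *)
move=> [n i]; exists (Some i), (fun k => (n, i - k)); split; last split.
- by rewrite subn0.
- by move=> k /= lt_ki; split=> //=; left; lia.
- move=> [m j] /chains_reduce_fst /= <-; exists i; split; first exact: le_n.
  by rewrite subnn; apply: chains_reduce_bottom.
Qed.

(** * Failure of the properties in an ultrapower of the chains *)

Section NonprincipalUltrapower.
Variable U : set_system nat.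
Hypotheses (ultraU : UltraFilter U) (ooU : (\oo `<=` U)%classic).

Let properU : ProperFilter U := ultra_proper.

Local Notation Q := (ultrapower U chains).
Local Notation "[ 'cls' n => E ]" :=
  (@ultra_class nat U chains (fun n => E) : Q) (at level 0, n name).

(** Non-principality enters here: [U] extends the filter of cofinite sets. *)
Lemma ultra_gt (k : nat) : U (fun n => k < n).
Proof. by apply: ooU; exists k.+1. Qed.

Lemma ultra_zero_normal : normal_form [cls n => (n, 0)].
Proof.
move=> [c]; have [f ->] := ultra_class_surj c.
move=> /(ultra_stepE ultraU) /filter_ex[n [_ []]] //=.
by case.
Qed.

Lemma ultra_diagonal_reducts (c : Q) :
  reduces [cls n => (n, n)] c -> exists k, c = [cls n => (n, n - k)].
Proof.
(* The start is generalised to any [n - k], so that the induction hypotheses compose in the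
   transitivity case. *)
have gen (x y : Q) : reduces x y ->
    (exists k, x = [cls n => (n, n - k)]) -> exists k, y = [cls n => (n, n - k)].
  elim=> {x y} [x y xy [k xE] | // | x y z _ IHy _ IHz /IHy/IHz //].
  have [f yE] := ultra_class_surj y; rewrite {}yE {}xE in xy *.
  exists k.+1; apply/(ultra_class_eq ultraU).
  move/(ultra_stepE ultraU) in xy.
  apply: filterS (filterI xy (ultra_gt k)) => n /=.
  (* The additional step starts at [n.+1], above [n - k], so only the decrement to [n - k.+1]
     remains. *)
  by case: (f n) => m j [[/= <- [|[]]] H lt_kn]; [congr pair|]; lia.
move=> /gen; apply; exists 0.
by apply/(ultra_class_eq ultraU); apply: filterE => n; rewrite subn0.
Qed.

(** A reduction has finite length, so it would give a fixed [k] with [n - k = 0] for almost all [n],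
    contradicting [k < n] for almost all [n]. *)
Lemma ultra_diagonal_not_zero :
  ~ reduces [cls n => (n, n)] [cls n => (n, 0)].
Proof.
move=> /ultra_diagonal_reducts[k /(ultra_class_eq ultraU) eqU].
have [n [/= []]] := filter_ex (filterI eqU (ultra_gt k)); lia.
Qed.

Lemma ultra_step_diagonal :
  step [cls n => (n, n.+1)] [cls n => (n, n)].
Proof. by apply/(ultra_stepE ultraU); apply: filterE => n; split=> //; left. Qed.

Lemma ultra_step_zero :
  step [cls n => (n, n.+1)] [cls n => (n, 0)].
Proof. by apply/(ultra_stepE ultraU); apply: filterE => n; split=> //; right. Qed.

Lemma ultrapower_chains_not_WCR : ~ WCR Q.
Proof.
move=> /(_ _ _ _ ultra_step_diagonal ultra_step_zero)[d [bd cd]].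
by move: bd; rewrite (normal_form_reduces ultra_zero_normal cd); apply: ultra_diagonal_not_zero.
Qed.

Lemma ultrapower_chains_not_NFP : ~ NFP Q.
Proof.
move=> /(_ [cls n => (n, n)] _ ultra_zero_normal) nfp.
apply/ultra_diagonal_not_zero/nfp.
(* The conversion goes up to the peak [n.+1] and takes the additional step down to [0]. *)
apply: (rt_trans _ _ _ [cls n => (n, n.+1)]); apply: rt_step.
- by right; apply: ultra_step_diagonal.
- by left; apply: ultra_step_zero.
Qed.

End NonprincipalUltrapower.

Theorem theorem3p16 :
  ~ generalised_first_order CR /\
  ~ generalised_first_order WCR /\
  ~ generalised_first_order NFP /\
  ~ generalised_first_order CP /\
  ~ generalised_first_order (neg_prop CR) /\
  ~ generalised_first_order (neg_prop WCR) /\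
  ~ generalised_first_order (neg_prop NFP) /\
  ~ generalised_first_order (neg_prop CP).
Proof.
(* An ultrafilter extending the cofinite filter on [nat], hence non-principal. *)
have [U [ultraU ooU]] := ultraFilterLemma eventually_filter.
have equivU := ultrapower_equiv chains ultraU.
have crA := CP_CR chains_CP.
have nWCR := ultrapower_chains_not_WCR ultraU ooU.
have nCR : ~ CR (ultrapower U chains) by move=> /CR_WCR.
have nCP : ~ CP (ultrapower U chains) by move=> /CP_CR.
have [? ?] := not_generalised_first_order equivU crA nCR.
have [? ?] := not_generalised_first_order equivU (CR_WCR crA) nWCR.
have [? ?] := not_generalised_first_order equivU (CR_NFP crA)
  (ultrapower_chains_not_NFP ultraU ooU).
have [? ?] := not_generalised_first_order equivU chains_CP nCP.
by [].
Qed.
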